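(* Let $G$ be a group and $X$ a $G$-set such that: (i) $\mathrm{Conj}_G(X)$ is infinite; (ii) for every $[H]\in\mathrm{Conj}_G(X)\setminus\{[G]\}$, except possibly finitely many, there exists $[K]\in\mathrm{Conj}_G(X)$ such that $[H]<[K]$. Then the monoid $\mathrm{End}_G(X)$ is not finitely generated.
   Context: $\mathrm{End}_G(X)$ is the monoid (under composition) of $G$-equivariant functions $X\to X$. $[H]$ is the $G$-conjugacy class of a subgroup $H\le G$, and $\mathrm{Conj}_G(X)=\{[G_x]:x\in X\}$ where $G_x$ is the stabilizer of $x$. On conjugacy classes of subgroups, $[H]\le[K]$ means that there exists $g\in G$ with $H\le g^{-1}Kg$, and $[H]<[K]$ means $[H]\le[K]$ and $[H]\ne[K]$. *)

(* Defs.v *)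
From HB Require Import structures.
From mathcomp Require Import all_boot all_classical.

Set Implicit Arguments.
Unset Strict Implicit.
Unset Printing Implicit Defensive.

Local Open Scope classical_set_scope.
Local Open Scope group_scope.

(* [G : groupType] may be infinite; its [choiceType] structure is no
   restriction, as every type carries one classically ([gen_choiceMixin]).
   Actions are on the left. *)
Record gset (G : groupType) := GSet {
  gset_sort :> Type;
  gact : G -> gset_sort -> gset_sort;
  gact1 : forall x, gact 1 x = x;
  gactM : forall g h x, gact (g * h) x = gact g (gact h x)
}.

Section ConjugacyClasses.
Variable G : groupType.
Implicit Types (H K : set G) (C D : set (set G)).

(* [k ^ g] is [g^-1 * k * g], so this is the subgroup g^-1 K g. *)
Definition conjugate K (g : G) : set G := [set k ^ g | k in K].

Definition conj_class H : set (set G) := range (conjugate H).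

Definition class_le C D :=
  exists H K, [/\ C = conj_class H, D = conj_class K &
                  exists g, H `<=` conjugate K g].

Definition class_lt C D := class_le C D /\ C <> D.

Lemma conjugateP K g x : conjugate K g x <-> K (x ^ g^-1).
Proof.
split=> [[k Kk <-]|Kx]; first by rewrite -conjgM mulgV conjg1.
by exists (x ^ g^-1) => //; rewrite -conjgM mulVg conjg1.
Qed.

Lemma conjugate1 K : conjugate K 1 = K.
Proof. by apply/seteqP; split=> x; rewrite conjugateP invg1 conjg1. Qed.

Lemma conjugateM K g h : conjugate K (g * h) = conjugate (conjugate K g) h.
Proof. by apply/seteqP; split=> x; rewrite !conjugateP -conjgM invgM. Qed.

Lemma conjugateS H K g : H `<=` K -> conjugate H g `<=` conjugate K g.
Proof. exact: image_subset. Qed.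

Lemma conj_classP H K : conj_class H = conj_class K <->
  exists g, H = conjugate K g.
Proof.
split=> [e|[g ->]].
  have: conj_class H H by exists 1; rewrite ?conjugate1.
  by rewrite e => -[g _ <-]; exists g.
apply/seteqP; split=> _ [h _ <-].
  by exists (g * h); rewrite ?conjugateM.
by exists (g^-1 * h); rewrite // -conjugateM mulgA mulgV mul1g.
Qed.

(* The order does not depend on the choice of representatives. *)
Lemma class_leP H K : class_le (conj_class H) (conj_class K) <->
  exists g, H `<=` conjugate K g.
Proof.
split=> [[H' [K' [/conj_classP[a ->] /esym/conj_classP[b ->] [g sHK]]]]|sHK].
  by exists (b * g * a)%g; rewrite 2!conjugateM; exact: conjugateS.
by exists H, K.
Qed.

End ConjugacyClasses.

Section EquivariantMaps.
Variables (G : groupType) (X : gset G).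

Definition stabilizer (x : X) : set G := [set g | gact g x = x].

Lemma stabilizer_group_closed x : group_closed (mem (stabilizer x)).
Proof.
split; first by rewrite inE /stabilizer /= gact1.
move=> g h; rewrite !inE /stabilizer /= => gx hx.
by rewrite gactM -{1}hx -(gactM h^-1) mulVg gact1.
Qed.

Definition Conj : set (set (set G)) :=
  [set conj_class (stabilizer x) | x in [set: X]].

Record EndG := MkEndG {
  EndG_fun :> X -> X;
  EndG_equivariant : forall g x, EndG_fun (gact g x) = gact g (EndG_fun x)
}.

Lemma EndG_eqP (f f' : EndG) : f =1 f' -> f = f'.
Proof.
case: f f' => [f ef] [f' ef'] /= /funext e; case: _ / e in ef' *.
by rewrite (Prop_irrelevance ef ef').
Qed.

Definition EndG_one : EndG := @MkEndG id (fun _ _ => erefl).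

Lemma EndG_mul_equivariant (f f' : EndG) g x :
  (f \o f') (gact g x) = gact g ((f \o f') x).
Proof. by rewrite /= !EndG_equivariant. Qed.

Definition EndG_mul (f f' : EndG) : EndG := MkEndG (EndG_mul_equivariant f f').

Lemma EndG_mulA : associative EndG_mul.
Proof. by move=> f f' f''; apply: EndG_eqP. Qed.

Lemma EndG_mul1 : left_id EndG_one EndG_mul.
Proof. by move=> f; apply: EndG_eqP. Qed.

Lemma EndG_mulr1 : right_id EndG_one EndG_mul.
Proof. by move=> f; apply: EndG_eqP. Qed.

HB.instance Definition _ := gen_eqMixin EndG.
HB.instance Definition _ := gen_choiceMixin EndG.
HB.instance Definition _ := isMonoid.Build EndG EndG_mulA EndG_mul1 EndG_mulr1.

End EquivariantMaps.

Definition finitely_generated (M : monoidType) :=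
  exists S : set M, finite_set S /\
    smallest (fun T : set M => monoid_closed (mem T)) S = [set: M].

(* Main.v *)
Require Import Defs.
From mathcomp Require Import all_boot all_classical.

(** A finitely generated monoid is countable, whereas [EndG X] is not: if [C]
    is a class lying strictly below another one then some endomorphism moves
    a point of type [C], and since an endomorphism can be prescribed
    independently on the points of each type, the infinitely many such classes
    yield at least [2 ^ aleph_0] endomorphisms. *)

Local Open Scope classical_set_scope.

Lemma finitely_generated_countable (M : monoidType) :
  finitely_generated M -> countable [set: M].
Proof.
move=> [S [/finite_seqP[s ->] gens]].
(* Letters are indices into [s]; an out-of-range index reads as [1], so every word denotes an
   element. *)
pose word (w : seq nat) : M := (\prod_(i <- w) nth 1 s i)%g.
suff all_words : [set: M] `<=` range word.
  apply: sub_countable (subset_card_le all_words) _.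
  exact: sub_countable (card_image_le _ _) (countableP _).
rewrite -gens; apply: smallest_sub => [|x sx].
  split; first by rewrite inE; exists [::] => //; rewrite /word big_nil.
  move=> _ _ /set_mem[v _ <-] /set_mem[w _ <-]; rewrite inE.
  by exists (v ++ w) => //; rewrite /word big_cat.
by exists [:: index x s]; rewrite // /word big_seq1 nth_index.
Qed.

Section Moving.
Variables (G : groupType) (X : gset G).
Implicit Types (x y z : X) (C : set (set G)).
Local Open Scope group_scope.

Lemma gactK (g : G) x : gact g^-1 (gact g x) = x.
Proof. by rewrite -gactM mulVg gact1. Qed.

Lemma gactVK (g : G) x : gact g (gact g^-1 x) = x.
Proof. by rewrite -gactM mulgV gact1. Qed.

Lemma stabilizer_gact (g : G) x :
  stabilizer (gact g x) = conjugate (stabilizer x) g^-1.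
Proof.
apply/seteqP; split=> h; rewrite conjugateP invgK /stabilizer/= conjgE !gactM.
  by move=> ->; rewrite gactK.
by by move=> /(congr1 (gact g)); rewrite !gactVK.
Qed.

Definition point_class x := conj_class (stabilizer x).

Lemma point_class_gact (g : G) x : point_class (gact g x) = point_class x.
Proof. by apply/conj_classP; exists g^-1; exact: stabilizer_gact. Qed.

(** The map sends [gact g x] to [gact g y] and is the identity off the orbit of [x]. *)
Lemma EndG_move_point x y : stabilizer x `<=` stabilizer y ->
  exists f : EndG X, f x = y.
Proof.
move=> sxy.
pose f z := if pselect (exists g, z = gact g x) is left e
            then gact (projT1 (cid e)) y else z.
have f_orbit g : f (gact g x) = gact g y.
  rewrite /f; case: pselect => [e|[]]; last by exists g.
  case: (cid e) => h /= gxhx.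
  (* The inclusion of stabilizers makes the value independent of the chosen representative [h]. *)
  have : stabilizer x (h^-1 * g) by rewrite /stabilizer/= gactM gxhx gactK.
  by move=> /sxy; rewrite /stabilizer/= gactM => {1}<-; rewrite gactVK.
have f_off z : ~ (exists g, z = gact g x) -> f z = z by rewrite /f; case: pselect.
have equivariant_f g z : f (gact g z) = gact g (f z).
  have [[h ->]|offz] := pselect (exists h, z = gact h x).
    by rewrite -gactM !f_orbit gactM.
  rewrite !f_off// => -[h gz]; apply: offz; exists (g^-1 * h).
  by rewrite gactM -gz gactK.
exists (MkEndG equivariant_f) => /=.
by have := f_orbit 1; rewrite !gact1.
Qed.

Lemma EndG_move_class C D : Conj X C -> Conj X D -> class_lt C D ->
  exists (f : EndG X) x, point_class x = C /\ f x <> x.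
Proof.
move=> [x _ <-] [y _ <-] [/class_leP[g sxy] neq].
(* The stabilizer of [gact g^-1 y] is the conjugate by [g] of that of [y]. Were this point equal to
   [x], the two classes would coincide. *)
have [|f fx] := @EndG_move_point x (gact g^-1 y).
  by rewrite stabilizer_gact invgK.
exists f, x; split=> //; rewrite fx => yx; apply: neq.
by rewrite -[LHS]/(point_class x) -yx point_class_gact.
Qed.

(** Equivariance survives because the class of a point is constant on its orbit. *)
Lemma EndG_glue (F : set (set G) -> EndG X) :
  exists f : EndG X, forall x, f x = F (point_class x) x.
Proof.
have equivariant_f g x :
    F (point_class (gact g x)) (gact g x) = gact g (F (point_class x) x).
  by rewrite point_class_gact EndG_equivariant.
by exists (MkEndG equivariant_f).
Qed.

Lemma EndG_uncountable (A : set (set (set G))) : infinite_set A ->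
  (forall C, A C -> exists (f : EndG X) x, point_class x = C /\ f x <> x) ->
  ~ countable [set: EndG X].
Proof.
move=> /infiniteP leNA moveA leEN.
(* Countability would inject the endomorphisms into [A], giving each [e] its own class [j e], with a
   point [x e] of that class moved by [h (j e)]. *)
have [j jA jI] := injfunPex.1 (elimT pcard_leP (card_le_trans leEN leNA)).
have /choice[h hP] C : exists f : EndG X,
    A C -> exists x, point_class x = C /\ f x <> x.
  by have [/moveA[f fP]|nAC] := pselect (A C); [exists f | exists 1].
have /choice[x xP] e := hP _ (jA e I).
(* Diagonal argument: the glued map moves [x e] iff [e] does not. *)
pose F C := if `[< exists e, j e = C /\ e (x e) = x e >] then h C else 1.
have [f fF] := EndG_glue F; have [xf_class moved] := xP f.
(* At [x f]: a witness [e] equals [f] by injectivity, so [f] would fix a point that it moves;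
   without a witness, [f] fixes [x f] and is itself one. *)
have := fF (x f); rewrite xf_class /F; case: asboolP => [[e [jef]]|nfix fx].
  by rewrite (jI e f) ?inE// => -> /esym.
by apply: nfix; exists f.
Qed.

End Moving.

Theorem corollary24 (G : groupType) (X : gset G)
  (Conj_infinite : infinite_set (Conj X))
  (Conj_above : exists E : set (set (set G)), finite_set E /\
     forall C, (Conj X `\ conj_class [set: G]) C -> ~ E C ->
       exists D, Conj X D /\ class_lt C D) :
  ~ finitely_generated (EndG X).
Proof.
case: Conj_above => E [finE above] /finitely_generated_countable.
(* Discarding the finitely many exceptional classes leaves infinitely many, each strictly below
   another. *)
apply: (@EndG_uncountable G X (Conj X `\` (conj_class [set: G] |` E))).
  by apply: infinite_setD => //; rewrite finite_setU.
move=> C [XC /not_orP[CG EC]].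
have [D [XD ltCD]] := above C (conj XC CG) EC.
exact: EndG_move_class XC XD ltCD.
Qed.
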